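(* Let $c>1$, $\theta\in\mathbb{R}$, and let $a,b\in\mathbb{R}$ be constants with $ab\neq0$ and $a^2\neq b^2$. Let $M$ be a Lorentzian surface with coordinates $(x,y)$ and metric $e^{f(x,y)}(dx^2-dy^2)$, and let $F_c$ be the elliptic hyperboloid with Lorentzian metric $$(c^2\sin^2R+\cos^2R)\,dR^2-\sin^2R\,dS^2 .$$ Put $\omega=\dfrac{a^2+b^2}{b^2-a^2}\,\dfrac{1}{\sqrt{c^2-1}}$. Then the map $u=(R,S):M\to F_c$ given by $$R(x,y)=\arccos\bigl(\cosh\theta\,\sin(\omega(ay-bx))\bigr),$$ $$S(x,y)=ax+by+\frac{2ab}{b^2-a^2}(ay-bx)+\operatorname{arctanh}\bigl(\sinh\theta\,\tan(\omega(ay-bx))\bigr)$$ is a Lorentzian wave map on the open set where the map is well defined and its Jacobian is nonvanishing.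
   Context: $F_c$ denotes the elliptic hyperboloid of one sheet $\frac{x^2}{c^2}+y^2-z^2=1$ with the Lorentzian metric induced from $\mathbb{R}^{2,1}$, which in suitable coordinates $(R,S)$ has the displayed form. Here $f$ is a smooth real function, and the Jacobian of $u$ is the determinant $R_xS_y-R_yS_x$. A smooth map $u=(R,S)$ from a surface with metric $e^{f}(dx^2-dy^2)$ to a surface with metric $A(R)dR^2-B(R)dS^2$ is called a (Lorentzian) wave map if it is a critical point (with respect to smooth compactly supported variations of $(R,S)$) of the energy, which up to a positive constant factor is $$E(u)=\int\Bigl(A(R)(R_x^2-R_y^2)-B(R)(S_x^2-S_y^2)\Bigr)dx\,dy;$$ here $A(R)=c^2\sin^2R+\cos^2R$ and $B(R)=\sin^2R$. *)

(* Defs.v *)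
From mathcomp Require Import all_boot all_order all_algebra.
From mathcomp Require Import all_classical all_reals all_analysis.
Set Implicit Arguments.
Unset Strict Implicit.
Unset Printing Implicit Defensive.
Import Order.TTheory GRing.Theory Num.Theory.
Import numFieldNormedType.Exports.
Local Open Scope classical_set_scope.
Local Open Scope ring_scope.

Definition cosh {R : realType} (x : R) : R := (expR x + expR (- x)) / 2.

Definition sinh {R : realType} (x : R) : R := (expR x - expR (- x)) / 2.

(* Inverse of tanh, meaningful only for `|x| < 1. *)
Definition arctanh {R : realType} (x : R) : R := ln ((1 + x) / (1 - x)) / 2.

Definition partial_x {R : realType} (g : R * R -> R) (p : R * R) : R :=
  'D_((1, 0) : R * R) g p.

Definition partial_y {R : realType} (g : R * R -> R) (p : R * R) : R :=
  'D_((0, 1) : R * R) g p.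

(* The letter [false] stands for d/dx and [true] for d/dy. *)
Definition iter_partial {R : realType} (w : seq bool) (g : R * R -> R) :
    R * R -> R :=
  foldr (fun (i : bool) h => if i then partial_y h else partial_x h) g w.

Definition smooth_on {R : realType} (U : set (R * R)) (g : R * R -> R) : Prop :=
  forall (w : seq bool) (p : R * R), U p ->
    [/\ {for p, continuous (iter_partial w g)},
        derivable (iter_partial w g) p ((1, 0) : R * R)
      & derivable (iter_partial w g) p ((0, 1) : R * R)].

Definition jacobian_det {R : realType} (Rf Sf : R * R -> R) (p : R * R) : R :=
  partial_x Rf p * partial_y Sf p - partial_y Rf p * partial_x Sf p.

(* Trace, with respect to the metric e^f (dx^2 - dy^2), of the pull-back of
   the metric A(R) dR^2 - B(R) dS^2 by the map (Rf, Sf). *)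
Definition energy_density {R : realType} (f : R * R -> R) (A B : R -> R)
    (Rf Sf : R * R -> R) (p : R * R) : R :=
  expR (- f p) *
    (A (Rf p) * (partial_x Rf p ^+ 2 - partial_y Rf p ^+ 2)
     - B (Rf p) * (partial_x Sf p ^+ 2 - partial_y Sf p ^+ 2)).

(* The factor [expR (f p)] is the density of the volume form of
   e^f (dx^2 - dy^2) with respect to dx dy. *)
Definition energy {R : realType} (f : R * R -> R) (A B : R -> R)
    (K : set (R * R)) (Rf Sf : R * R -> R) : R :=
  \int[(@lebesgue_measure R \x @lebesgue_measure R)%E]_(p in K)
    (energy_density f A B Rf Sf p * expR (f p)).

(* The open set U carries the metric e^f (dx^2 - dy^2).  The positivity
   condition says that the image lies where A(R) dR^2 - B(R) dS^2 is a
   Lorentzian metric.  As U need not have compact closure, a variation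
   supported in the compact set K is tested against the energy over K. *)
Definition lorentzian_wave_map {R : realType} (f : R * R -> R) (A B : R -> R)
    (U : set (R * R)) (Rf Sf : R * R -> R) : Prop :=
  [/\ smooth_on U Rf, smooth_on U Sf,
      forall p, U p -> 0 < A (Rf p) /\ 0 < B (Rf p)
    & forall (K : set (R * R)) (phi psi : R * R -> R),
        compact K -> K `<=` U ->
        smooth_on setT phi -> smooth_on setT psi ->
        (forall p, ~ K p -> phi p = 0 /\ psi p = 0) ->
        is_derive (0 : R) (1 : R)
          (fun t : R => energy f A B K (fun p => Rf p + t * phi p)
                                       (fun p => Sf p + t * psi p))
          (0 : R)].

(* Main.v *)
Require Import Defs.
From mathcomp Require Import all_boot all_order all_algebra.
From mathcomp Require Import all_classical all_reals all_analysis.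
From mathcomp Require Import ring.
Import Order.TTheory GRing.Theory Num.Theory.
Import numFieldNormedType.Exports.
Local Open Scope classical_set_scope.
Local Open Scope ring_scope.

(** Write v = a y - b x and alpha = omega v, and let a prime denote d/dv.  In
    these variables R depends on v alone and S = a x + b y + k v + h(v), with
    k = 2ab/(b^2 - a^2) and h = arctanh (sinh theta tan alpha).  Since
    v_x^2 - v_y^2 = b^2 - a^2, the wave map system
    - (B S_x)_x = (B S_y)_y,
    - 2 (A R_x)_x - 2 (A R_y)_y = A'(R) (R_x^2 - R_y^2) - B'(R) (S_x^2 - S_y^2)
    becomes a pair of ordinary differential equations in v.  The slope k
    cancels the mixed term of the first one, which reduces to (B h')' = 0; it
    holds because B = sin^2 R = 1 - cosh^2 theta sin^2 alpha and
    h' = omega sinh theta / B.  For the second one,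
    S_x^2 - S_y^2 = (b^2 - a^2) (h'^2 - 1 - k^2), and omega is chosen so that
    1 + k^2 = omega^2 (c^2 - 1); multiplied by R', the equation then says that
    A R'^2 - omega^2 (c^2 - 1) B - omega^2 sinh^2 theta / B is constant, which
    follows from R'^2 = omega^2 (1 + sinh^2 theta / B) and A = 1 + (c^2 - 1) B.
    These two identities are [solution_euler_lagrange_longitude] and
    [solution_euler_lagrange_colatitude].

    The Jacobian equals - (a^2 + b^2) R', which vanishes nowhere where
    cos alpha <> 0, and sinh^2 tan^2 < 1 amounts to cosh^2 sin^2 < 1.  Hence the
    set of the statement is the intersection of M with [regular_domain], an open
    set on which sin R > 0.  Smoothness comes from the fact that R, S,
    sin alpha, cos alpha and 1 / sin R have partial derivatives that are
    polynomials in the last three ([smooth_on_regular_domain]).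

    The passage from the differential equations to criticality is
    [euler_lagrange_wave_map].  The energy over the compact set K is
    differentiated under the integral sign ([derive_integral_lagrangian]), and
    the first variation is then a sum of divergences of fields supported in K,
    each of integral zero by Fubini and the fundamental theorem of calculus
    ([integral_by_parts_compact]).  The conformal factor e^f cancels against
    the density of the volume form. *)

(** * Measurability and integrability in the plane *)

(** The plane is second countable: an open set is a countable union of boxes
    with rational corners. *)
Lemma measurable_open_plane {R : realType} {O : set (R * R)} :
  open O -> measurable O.
Proof.
move=> oO.
pose box (i : (rat * rat) * (rat * rat)) : set (R * R) :=
  `]ratr i.1.1, ratr i.1.2[ `*` `]ratr i.2.1, ratr i.2.2[.
have -> : O = \bigcup_i (if `[< box i `<=` O >] then box i else set0).
  apply/seteqP; split=> [p Op|p [i _]]; last first.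
    by case: asboolP => // sub /sub.
  have [e /= e0 sub] : nbhs_ball p O by rewrite nbhs_ballE; exact: oO.
  (* The end points of an open interval around x inside ball x e. *)
  have rat_itv (x : R) : exists r : rat * rat,
      [set` `]ratr r.1, ratr r.2[] x /\
        `]ratr r.1, ratr r.2[ `<=` ball x e.
    have [s] : exists s, ratr s \in `]x - e, x[.
      by apply: rat_in_itvoo; rewrite ltrBlDr ltrDl.
    have [t] : exists t, ratr t \in `]x, x + e[.
      by apply: rat_in_itvoo; rewrite ltrDl.
    rewrite !in_itv/= => /andP[xt te] /andP[es sx].
    exists (s, t); split=> /=; first by rewrite in_itv/= sx xt.
    move=> z /=; rewrite ball_itv /= !in_itv/= => /andP[sz zt].
    by rewrite (lt_trans es)//= (lt_trans zt).
  have [r1 [pr1 sub1]] := rat_itv p.1.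
  have [r2 [pr2 sub2]] := rat_itv p.2.
  exists (r1, r2) => //; rewrite asboolT; first by split.
  by move=> z [/= /sub1 z1 /sub2 z2]; apply: sub; split.
apply: countable_bigcupT_measurable => [|i]; first exact: countableP.
by case: ifP => _; [apply: measurableX|apply: measurable0].
Qed.

Lemma open_continuous_preimage {T S : topologicalType} {U : set T}
    {g : T -> S} {O : set S} :
  open U -> (forall p, U p -> {for p, continuous g}) -> open O ->
  open (U `&` g @^-1` O).
Proof.
move=> oU cg oO; rewrite openE => p [Up Ogp]; rewrite /interior.
apply: filterI; first exact: open_nbhs_nbhs.
by apply: (cg p Up); exact: open_nbhs_nbhs.
Qed.

Lemma measurable_fun_plane {R : realType} {U : set (R * R)} {g : R * R -> R} :
  open U -> (forall p, U p -> {for p, continuous g}) -> measurable_fun U g.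
Proof.
move=> oU cg mU; apply: (measurability _
  (measurable_realfun.RGenOpens.measurableE R)) => //.
move=> _ [_ [a [b ->] <-]]; apply: measurable_open_plane.
by apply: open_continuous_preimage => //; exact: interval_open.
Qed.

Lemma hausdorff_plane {R : realType} : hausdorff_space (R * R)%type.
Proof. exact: (@norm_hausdorff R (R * R)%type). Qed.

Lemma compact_closed_plane {R : realType} {K : set (R * R)} :
  compact K -> closed K.
Proof.
by move=> cK; apply: compact_closed => //; exact: (@hausdorff_plane R).
Qed.

Lemma measurable_compact_plane {R : realType} {K : set (R * R)} :
  compact K -> measurable K.
Proof.
move=> cK; rewrite -[K]setCK; apply: measurableC; apply: measurable_open_plane.
by apply: closed_openC; exact: compact_closed_plane.
Qed.

Lemma compact_plane_box {R : realType} {K : set (R * R)} : compact K ->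
  exists2 N : R, 0 < N & forall p, K p -> `|p.1| < N /\ `|p.2| < N.
Proof.
move=> /compact_bounded[N [_ N1]]; exists (`|N| + 1).
  by rewrite ltr_wpDl.
move=> p Kp; have := N1 (`|N| + 2^-1).
have -> : N < `|N| + 2^-1 by rewrite ltr_pwDr ?ler_norm ?invr_gt0.
move=> /(_ isT p Kp); rewrite /= prod_normE ge_max => /andP[p1 p2].
by split; apply: le_lt_trans; [exact: p1| |exact: p2|];
  rewrite ltrD2l invf_lt1 // ltr1n.
Qed.

Lemma measure_compact_plane {R : realType} {K : set (R * R)} : compact K ->
  ((@lebesgue_measure R \x @lebesgue_measure R)%E K < +oo)%E.
Proof.
move=> cK; have [N N0 KN] := compact_plane_box cK.
have mI : measurable (`[- N, N] : set R) by exact: measurable_itv.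
have KI : K `<=` `[- N, N] `*` `[- N, N].
  move=> p /KN[p1 p2] /=; rewrite !in_itv/= -!ler_norml.
  by split; exact: ltW.
have mK := measurable_compact_plane cK.
set mu := (_ \x _)%E.
apply: (@le_lt_trans _ _ (mu (`[- N, N] `*` `[- N, N]))).
  by apply: le_measure => //; rewrite inE//; exact: measurableX.
rewrite /mu product_measure1E//= lebesgue_measure_itv/=.
by case: ifP => _; rewrite ?mule0 ?ltry// -EFinB -EFinM ltry.
Qed.

Lemma integrable_compact_plane {R : realType} {K U : set (R * R)}
    {g : R * R -> R} :
  compact K -> open U -> K `<=` U -> (forall p, U p -> {for p, continuous g}) ->
  (@lebesgue_measure R \x @lebesgue_measure R)%E.-integrable K (EFin \o g).
Proof.
move=> cK oU KU cg; apply: measurable_bounded_integrable.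
- exact: measurable_compact_plane.
- exact: measure_compact_plane.
- apply: (measurable_funS _ KU); first exact: measurable_open_plane.
  exact: measurable_fun_plane.
- have : compact (g @` K).
    apply: continuous_compact => //; apply: continuous_in_subspaceT => p.
    by rewrite inE => /KU; exact: cg.
  move=> /compact_bounded[M [_ mrt]].
  exists M; split; rewrite ?num_real // => e Me p Kp.
  by apply: mrt => //; exists p.
Qed.

(** * Directional derivatives *)

(** Directional derivatives are derivatives of functions of one real variable,
    to which the chain rule applies. *)
Lemma is_derive_line {R : realType} {V : normedModType R} {g : V -> R}
    {p v : V} {d : R} :
  is_derive p v g d <-> is_derive (0 : R) (1 : R) (fun h => g (h *: v + p)) d.
Proof.
have E : (fun h : R => h^-1 *: ((g \o shift p) (h *: v) - g p)) =
    (fun h : R => h^-1 *: (((fun h => g (h *: v + p)) \o shift 0) (h *: 1)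
                      - g (0 *: v + p))).
  by apply/funext => h /=; rewrite addr0 scale0r add0r [h *: 1]mulr1.
by split=> -[dg <-]; split; rewrite /derivable /derive ?E // -E.
Qed.

Lemma is_derive_fst {R : realType} {g : R * R -> R} {p : R * R} {d : R} :
  is_derive p ((1, 0) : R * R) g d <->
  is_derive p.1 (1 : R) (fun x => g (x, p.2)) d.
Proof.
have E : (fun h : R => g (h *: ((1, 0) : R * R) + p)) =
    (fun h : R => g (h *: 1 + p.1, p.2)).
  apply/funext => h; rewrite {1}(surjective_pairing p); congr (g (_, _)).
  by rewrite /= [h *: 0]mulr0 add0r.
split=> /is_derive_line H; apply/is_derive_line.
  exact: (eq_ind _ (fun f => is_derive (0 : R) (1 : R) f d) H _ E).
exact: (eq_ind _ (fun f => is_derive (0 : R) (1 : R) f d) H _ (esym E)).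
Qed.

Lemma is_derive_snd {R : realType} {g : R * R -> R} {p : R * R} {d : R} :
  is_derive p ((0, 1) : R * R) g d <->
  is_derive p.2 (1 : R) (fun y => g (p.1, y)) d.
Proof.
have E : (fun h : R => g (h *: ((0, 1) : R * R) + p)) =
    (fun h : R => g (p.1, h *: 1 + p.2)).
  apply/funext => h; rewrite {1}(surjective_pairing p); congr (g (_, _)).
  by rewrite /= [h *: 0]mulr0 add0r.
split=> /is_derive_line H; apply/is_derive_line.
  exact: (eq_ind _ (fun f => is_derive (0 : R) (1 : R) f d) H _ E).
exact: (eq_ind _ (fun f => is_derive (0 : R) (1 : R) f d) H _ (esym E)).
Qed.

Lemma is_derive_chain {R : realType} {V : normedModType R} {F : R -> R}
    {g : V -> R} {p v : V} {dF dg : R} :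
  is_derive p v g dg -> is_derive (g p) 1 F dF ->
  is_derive p v (fun x => F (g x)) (dF * dg).
Proof.
move=> /is_derive_line Dg DF; apply/is_derive_line.
have DF' : is_derive ((fun h : R => g (h *: v + p)) 0) 1 F dF.
  by rewrite /= scale0r add0r.
exact: (@is_derive1_comp _ F (fun h : R => g (h *: v + p))).
Qed.

Lemma is_derive_continuous {R : realType} {F F' : R -> R} :
  (forall z, is_derive z (1 : R) F (F' z)) -> continuous F.
Proof.
move=> DF x; apply: differentiable_continuous; apply/derivable1_diffP.
by have [] := DF x.
Qed.

(** * Integration by parts over a compact set *)

(** The fundamental theorem of calculus on [-N, N], an interval at whose end
    points G vanishes. *)
Lemma integral_derivative_eq0 {R : realType} {G d : R -> R} {N : R} :
  (forall x, is_derive x (1 : R) G (d x)) -> continuous d ->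
  (forall x, N <= `|x| -> G x = 0) -> (forall x, N <= `|x| -> d x = 0) ->
  0 < N -> (\int[@lebesgue_measure R]_x (d x)%:E = 0)%E.
Proof.
move=> Gd cd G0 d0 N0.
have NN : - N < N by rewrite gtrN.
have cG : continuous G := is_derive_continuous Gd.
have -> : (\int[@lebesgue_measure R]_x (d x)%:E =
           \int[@lebesgue_measure R]_(x in `[(- N)%R, N]) (d x)%:E)%E.
  rewrite [RHS]integral_mkcond; apply: eq_integral => x _.
  rewrite patchE; case: ifPn => //; rewrite notin_setE/= in_itv/= -ler_norml.
  by move=> /negP; rewrite -ltNge => /ltW/d0 ->.
rewrite (@continuous_FTC2 _ d G) //.
  by rewrite !G0 ?subee// ?normrN ler_norm.
- exact: continuous_subspaceT.
- split; first by move=> x _; have [] := Gd x.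
  + exact/cvg_at_right_filter/cG.
  + exact/cvg_at_left_filter/cG.
- by move=> x _; rewrite derive1E; have [] := Gd x.
Qed.

Lemma integral_outside_compact {R : realType} {K : set (R * R)}
    {D : R * R -> R} :
  compact K -> continuous D -> (forall p, ~ K p -> D p = 0) ->
  let mu := (@lebesgue_measure R \x @lebesgue_measure R)%E in
  mu.-integrable setT (EFin \o D) /\
  (\int[mu]_(p in K) (D p)%:E = \int[mu]_p (D p)%:E)%E.
Proof.
move=> cK cD D0 mu.
have E : (EFin \o D) \_ K = EFin \o D.
  apply/funext => p; rewrite patchE; case: ifPn => //.
  by rewrite notin_setE => /D0 /= ->.
split; last by rewrite integral_mkcond E.
rewrite -E; have mK := measurable_compact_plane cK.
apply: (iffLR (@integrable_mkcond _ _ R mu K (EFin \o D) mK)).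
by apply: (integrable_compact_plane cK openT) => // p _; exact: cD.
Qed.

(** The complement of K is open, so g vanishes on a whole neighbourhood of p. *)
Lemma partial_outside_compact {R : realType} {K : set (R * R)}
    {g : R * R -> R} {v : R * R} :
  compact K -> (forall p, ~ K p -> g p = 0) ->
  forall p, ~ K p -> is_derive p v g 0.
Proof.
move=> cK g0 p nKp.
apply: (near_eq_is_derive _ (is_derive_cst (0 : R) p v)).
have oK : open (~` K) by apply: closed_openC; exact: compact_closed_plane.
near=> q; rewrite /= g0 //; near: q.
exact: open_nbhs_nbhs.
Unshelve. all: end_near. Qed.

(** Fubini reduces the claim to horizontal lines, on which the integral of
    the derivative of a compactly supported function is zero. *)
Lemma integral_x_derivative_eq0 {R : realType} {K : set (R * R)}
    {g D : R * R -> R} :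
  compact K -> continuous D -> (forall p, ~ K p -> g p = 0) ->
  (forall p, is_derive p ((1, 0) : R * R) g (D p)) ->
  \int[(@lebesgue_measure R \x @lebesgue_measure R)%E]_(p in K) D p = 0.
Proof.
move=> cK cD g0 gD.
have D0 p : ~ K p -> D p = 0.
  move=> nKp; have [_ <-] := gD p.
  by have [_ ->] := @partial_outside_compact _ _ _ (1, 0) cK g0 p nKp.
have [N N0 KN] := compact_plane_box cK.
have nK (x y : R) : N <= `|x| -> ~ K (x, y).
  by move=> Nx /KN[/= + _]; rewrite ltNge Nx.
have [iD ED] := integral_outside_compact cK cD D0.
rewrite /Rintegral ED -integral21_prod_meas1 // integral0_eq // => y _.
rewrite /fubini_G /=.
apply: (@integral_derivative_eq0 _ (fun x => g (x, y)) (fun x => D (x, y)) N).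
- by move=> x; apply/(@is_derive_fst _ g (x, y)).
- move=> x; apply: (@continuous_comp _ _ _ (fun x => (x, y)) D); last exact: cD.
  exact: (cvg_pair cvg_id (cvg_cst y)).
- by move=> x /(nK x y) /g0.
- by move=> x /(nK x y) /D0.
- by [].
Qed.

Lemma integral_y_derivative_eq0 {R : realType} {K : set (R * R)}
    {g D : R * R -> R} :
  compact K -> continuous D -> (forall p, ~ K p -> g p = 0) ->
  (forall p, is_derive p ((0, 1) : R * R) g (D p)) ->
  \int[(@lebesgue_measure R \x @lebesgue_measure R)%E]_(p in K) D p = 0.
Proof.
move=> cK cD g0 gD.
have D0 p : ~ K p -> D p = 0.
  move=> nKp; have [_ <-] := gD p.
  by have [_ ->] := @partial_outside_compact _ _ _ (0, 1) cK g0 p nKp.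
have [N N0 KN] := compact_plane_box cK.
have nK (x y : R) : N <= `|y| -> ~ K (x, y).
  by move=> Ny /KN[_ /=]; rewrite ltNge Ny.
have [iD ED] := integral_outside_compact cK cD D0.
rewrite /Rintegral ED -integral12_prod_meas1 // integral0_eq // => x _.
rewrite /fubini_F /=.
apply: (@integral_derivative_eq0 _ (fun y => g (x, y)) (fun y => D (x, y)) N).
- by move=> y; apply/(@is_derive_snd _ g (x, y)).
- move=> y; apply: (@continuous_comp _ _ _ (fun y => (x, y)) D); last exact: cD.
  exact: (cvg_pair (cvg_cst x) cvg_id).
- by move=> y /(nK x y) /g0.
- by move=> y /(nK x y) /D0.
- by [].
Qed.

(** The direction of the partial derivative that [iter_partial] attaches to the
    letter i. *)
Definition axis {R : realType} (i : bool) : R * R :=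
  if i then (0, 1) else (1, 0).

(** The product u phi, which is zero outside K, is of class C^1 on the whole
    plane although u is only controlled on U: near a point of K it is a product
    of C^1 functions, and the complement of K is open. *)
Lemma integral_by_parts_compact {R : realType} {K U : set (R * R)} (i : bool)
    {u du phi dphi : R * R -> R} :
  compact K -> open U -> K `<=` U ->
  (forall p, U p -> is_derive p (axis i) u (du p)) ->
  (forall p, U p -> {for p, continuous u}) ->
  (forall p, U p -> {for p, continuous du}) ->
  (forall p, is_derive p (axis i) phi (dphi p)) ->
  continuous phi -> continuous dphi ->
  (forall p, ~ K p -> phi p = 0) ->
  \int[(@lebesgue_measure R \x @lebesgue_measure R)%E]_(p in K)
    (du p * phi p + u p * dphi p) = 0.
Proof.
move=> cK oU KU Du cu cdu Dphi cphi cdphi phi0.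
pose D := (fun p => du p * phi p + u p * dphi p) \_ K.
have dphi0 p : ~ K p -> dphi p = 0.
  move=> nKp; have [_ <-] := Dphi p.
  by have [_ ->] := @partial_outside_compact _ _ _ (axis i) cK phi0 p nKp.
have DE p : D p = du p * phi p + u p * dphi p.
  rewrite /D patchE; case: ifPn => //; rewrite notin_setE => nKp.
  by rewrite phi0// dphi0// !mulr0 addr0.
have oK : open (~` K) by apply: closed_openC; exact: compact_closed_plane.
have g0 p : ~ K p -> u p * phi p = 0 by move=> /phi0 ->; rewrite mulr0.
have cD : continuous D.
  move=> p; have [Kp|nKp] := pselect (K p).
    have -> : D = (du * phi + u * dphi)%R by apply/funext => q; rewrite DE.
    have Up := KU _ Kp.
    exact: cvgD (cvgM (cdu _ Up) (cphi p)) (cvgM (cu _ Up) (cdphi p)).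
  rewrite /continuous_at DE phi0// dphi0// !mulr0 addr0.
  apply: cvg_near_cst.
  have : nbhs p (~` K) by exact: open_nbhs_nbhs.
  by apply: filterS => q nKq; rewrite DE phi0// dphi0// !mulr0 addr0.
have gD p : is_derive p (axis i) (fun q => u q * phi q) (D p).
  have [Kp|nKp] := pselect (K p).
    rewrite DE; have Up := KU _ Kp.
    apply: is_derive_eq (is_deriveM (Du p Up) (Dphi p)) _.
    by rewrite addrC mulrC.
  rewrite DE phi0// dphi0// !mulr0 addr0.
  exact: partial_outside_compact cK g0 p nKp.
transitivity
  (\int[(@lebesgue_measure R \x @lebesgue_measure R)%E]_(p in K) D p).
  by apply: eq_Rintegral => p _; rewrite DE.
case: i gD {Du Dphi dphi0} => gD.
- exact: (integral_y_derivative_eq0 cK cD g0).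
- exact: (integral_x_derivative_eq0 cK cD g0).
Qed.

(** * The first variation of the energy *)

(** Lets the rules of differentiation, stated for sums and products of
    functions, be used for pointwise expressions. *)
Lemma eq_is_derive {R : realType} {V : normedModType R} {f g : V -> R}
    {x v : V} {df dg : R} :
  is_derive x v f df -> f =1 g -> df = dg -> is_derive x v g dg.
Proof. by move=> + /funext <- <-. Qed.

(** The integrand of the energy as a function of the 1-jet: r stands for R, and
    rx, ry, sx, sy for the partial derivatives of R and S. *)
Definition lagrangian {R : realType} (A B : R -> R) (r rx ry sx sy : R) : R :=
  A r * (rx ^+ 2 - ry ^+ 2) - B r * (sx ^+ 2 - sy ^+ 2).

(** The derivative of [lagrangian] in the direction (h, hx, hy, kx, ky). *)
Definition first_variation {R : realType} (A A' B B' : R -> R)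
    (r rx ry sx sy h hx hy kx ky : R) : R :=
  A' r * h * (rx ^+ 2 - ry ^+ 2) + A r * (2 * (rx * hx - ry * hy))
  - (B' r * h * (sx ^+ 2 - sy ^+ 2) + B r * (2 * (sx * kx - sy * ky))).

Lemma is_derive_lagrangian {R : realType} {A A' B B' : R -> R}
    (r rx ry sx sy h hx hy kx ky t : R) :
  (forall z, is_derive z (1 : R) A (A' z)) ->
  (forall z, is_derive z (1 : R) B (B' z)) ->
  is_derive t (1 : R)
    (fun t => lagrangian A B (r + t * h) (rx + t * hx) (ry + t * hy)
                             (sx + t * kx) (sy + t * ky))
    (first_variation A A' B B' (r + t * h) (rx + t * hx) (ry + t * hy)
                     (sx + t * kx) (sy + t * ky) h hx hy kx ky).
Proof.
move=> DA DB.
have aff (a b : R) : is_derive t (1 : R) (fun t => a + t * b) b.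
  apply: eq_is_derive (is_deriveD (is_derive_cst a t 1)
    (is_deriveM (is_derive_id t 1) (is_derive_cst b t 1))) _ _ => //.
  by rewrite scaler0 !add0r [_ *: _]mulr1.
have sq (a b a' b' : R) : is_derive t (1 : R)
    (fun t => (a + t * b) ^+ 2 - (a' + t * b') ^+ 2)
    (2 * ((a + t * b) * b - (a' + t * b') * b')).
  apply: eq_is_derive (is_deriveB (is_deriveX 2 (aff a b))
    (is_deriveX 2 (aff a' b'))) _ _ => //.
  by rewrite /GRing.scale/=; ring.
apply: eq_is_derive (is_deriveB
  (is_deriveM (is_derive_chain (aff r h) (DA _)) (sq rx hx ry hy))
  (is_deriveM (is_derive_chain (aff r h) (DB _)) (sq sx kx sy ky))) _ _ => //.
rewrite /first_variation /GRing.scale/=; ring.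
Qed.

(** Provides the constant that dominates the t-derivative of the integrand,
    uniformly for t in [-1, 1] and p in K. *)
Lemma bounded_compact_parameter {R : realType} {T : topologicalType}
    {K : set T} {F : R * T -> R} :
  compact K ->
  (forall z, K z.2 -> {for z, continuous F}) ->
  exists C : R, forall t p, `|t| <= 1 -> K p -> `|F (t, p)| <= C.
Proof.
move=> cK cF.
have cI : compact (`[(-1 : R), 1] `*` K).
  by apply: compact_setX => //; exact: segment_compact.
have /compact_bounded[C [_ CF]] : compact (F @` (`[(-1 : R), 1] `*` K)).
  apply: continuous_compact => //; apply: continuous_in_subspaceT => z.
  by rewrite inE => -[_ Kz]; exact: cF.
exists (`|C| + 1) => t p t1 Kp; apply: CF.
  by rewrite ltr_pwDr// ler_norm.
by exists (t, p) => //; split=> //=; rewrite in_itv/= -ler_norml.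
Qed.

Lemma continuous_lagrangian {R : realType} {T : topologicalType}
    {A B : R -> R} {r rx ry sx sy : T -> R} {z : T} :
  continuous A -> continuous B ->
  {for z, continuous r} -> {for z, continuous rx} -> {for z, continuous ry} ->
  {for z, continuous sx} -> {for z, continuous sy} ->
  {for z, continuous
    (fun z => lagrangian A B (r z) (rx z) (ry z) (sx z) (sy z))}.
Proof.
move=> cA cB cr crx cry csx csy.
have comp (F : R -> R) : continuous F -> {for z, continuous (fun z => F (r z))}.
  by move=> cF; exact: (continuous_comp cr (cF _)).
by apply: cvgB; apply: cvgM; by [exact: comp|apply: cvgB; apply: cvgM].
Qed.

Lemma continuous_first_variation {R : realType} {T : topologicalType}
    {A A' B B' : R -> R} {r rx ry sx sy h hx hy kx ky : T -> R} {z : T} :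
  continuous A -> continuous A' -> continuous B -> continuous B' ->
  {for z, continuous r} -> {for z, continuous rx} -> {for z, continuous ry} ->
  {for z, continuous sx} -> {for z, continuous sy} ->
  {for z, continuous h} -> {for z, continuous hx} -> {for z, continuous hy} ->
  {for z, continuous kx} -> {for z, continuous ky} ->
  {for z, continuous
    (fun z => first_variation A A' B B' (r z) (rx z) (ry z) (sx z) (sy z)
                              (h z) (hx z) (hy z) (kx z) (ky z))}.
Proof.
move=> cA cA' cB cB' cr crx cry csx csy ch chx chy ckx cky.
have comp (F : R -> R) : continuous F -> {for z, continuous (fun z => F (r z))}.
  by move=> cF; exact: (continuous_comp cr (cF _)).
have sq (g k : T -> R) : {for z, continuous g} -> {for z, continuous k} ->
    {for z, continuous (fun z => g z ^+ 2 - k z ^+ 2)}.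
  by move=> *; apply: cvgB; apply: cvgM.
have polar (g g' k k' : T -> R) : {for z, continuous g} ->
    {for z, continuous g'} -> {for z, continuous k} ->
    {for z, continuous k'} ->
    {for z, continuous (fun z => 2 * (g z * g' z - k z * k' z))}.
  by move=> *; apply: cvgM; [exact: cvg_cst|apply: cvgB; apply: cvgM].
apply: cvgB; apply: cvgD; apply: cvgM.
- by apply: cvgM => //; exact: comp.
- exact: sq.
- exact: comp.
- exact: polar.
- by apply: cvgM => //; exact: comp.
- exact: sq.
- exact: comp.
- exact: polar.
Qed.

(** Differentiation under the integral sign, with a constant as the dominating
    function: K has finite measure, and the t-derivative of the integrand is
    continuous in (t, p), hence bounded on the compact set [-1, 1] x K. *)
Lemma derive_integral_lagrangian {R : realType} {A A' B B' : R -> R}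
    {K U : set (R * R)} {r rx ry sx sy h hx hy kx ky : R * R -> R} :
  (forall z, is_derive z (1 : R) A (A' z)) ->
  (forall z, is_derive z (1 : R) B (B' z)) ->
  continuous A' -> continuous B' ->
  compact K -> open U -> K `<=` U ->
  (forall p, U p ->
     [/\ {for p, continuous r}, {for p, continuous rx}, {for p, continuous ry},
        {for p, continuous sx} & {for p, continuous sy}]) ->
  (forall p, U p ->
     [/\ {for p, continuous h}, {for p, continuous hx}, {for p, continuous hy},
        {for p, continuous kx} & {for p, continuous ky}]) ->
  is_derive (0 : R) (1 : R)
    (fun t => \int[(@lebesgue_measure R \x @lebesgue_measure R)%E]_(p in K)
       lagrangian A B (r p + t * h p) (rx p + t * hx p) (ry p + t * hy p)
                  (sx p + t * kx p) (sy p + t * ky p))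
    (\int[(@lebesgue_measure R \x @lebesgue_measure R)%E]_(p in K)
       first_variation A A' B B' (r p) (rx p) (ry p) (sx p) (sy p)
                       (h p) (hx p) (hy p) (kx p) (ky p)).
Proof.
move=> DA DB cA' cB' cK oU KU cu cv.
have cA := is_derive_continuous DA; have cB := is_derive_continuous DB.
pose e t p := lagrangian A B (r p + t * h p) (rx p + t * hx p)
  (ry p + t * hy p) (sx p + t * kx p) (sy p + t * ky p).
pose e' t p := first_variation A A' B B' (r p + t * h p) (rx p + t * hx p)
  (ry p + t * hy p) (sx p + t * kx p) (sy p + t * ky p)
  (h p) (hx p) (hy p) (kx p) (ky p).
have De t p : is_derive t (1 : R) (e^~ p) (e' t p).
  exact: is_derive_lagrangian.
have E1 t p : partial1of2 e t p = e' t p.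
  by rewrite partial1of2E; have [] := De t p.
have lift (g : R * R -> R) (z : R * (R * R)) : {for z.2, continuous g} ->
    {for z, continuous (fun z : R * (R * R) => g z.2)}.
  move=> cg; have csnd : {for z, continuous (snd : R * (R * R) -> R * R)}.
    apply: cvg_snd.
  exact: (continuous_comp csnd cg).
have aff (g g' : R * R -> R) (z : R * (R * R)) : {for z.2, continuous g} ->
    {for z.2, continuous g'} ->
    {for z, continuous (fun z : R * (R * R) => g z.2 + z.1 * g' z.2)}.
  move=> c1 c2; apply: cvgD; first exact: lift.
  by apply: cvgM; [apply: cvg_fst|exact: lift].
have ce' (z : R * (R * R)) : U z.2 ->
    {for z, continuous (fun z : R * (R * R) => e' z.1 z.2)}.
  move=> Uz; have [? ? ? ? ?] := cu _ Uz; have [? ? ? ? ?] := cv _ Uz.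
  by apply: continuous_first_variation => //; by [exact: aff|exact: lift].
have [C e'C] := bounded_compact_parameter cK (fun z Kz => ce' z (KU _ Kz)).
have inte t : (@lebesgue_measure R \x @lebesgue_measure R)%E.-integrable K
    (EFin \o e t).
  apply: (integrable_compact_plane cK oU KU) => p Up.
  have [? ? ? ? ?] := cu _ Up; have [? ? ? ? ?] := cv _ Up.
  by apply: continuous_lagrangian => //; apply: cvgD => //;
    apply: cvgM => //; exact: cvg_cst.
have I0 : `](-1 : R), 1[%classic 0 by rewrite /= in_itv/= ltrN10 ltr01.
have De' t p : `](-1 : R), 1[%classic t -> K p -> derivable (e^~ p) t 1.
  by move=> _ _; have [] := De t p.
have intC : (@lebesgue_measure R \x @lebesgue_measure R)%E.-integrable K
    (EFin \o cst `|C|).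
  by apply: (integrable_compact_plane cK oU KU) => p _; exact: cvg_cst.
have bound t p : `](-1 : R), 1[%classic t -> K p ->
    `|partial1of2 e t p| <= cst `|C| p.
  rewrite /= in_itv/= E1 => /andP[t1 t2] Kp.
  rewrite (le_trans _ (ler_norm C))//; apply: (e'C t p) => //.
  by rewrite ler_norml !ltW.
have mK := measurable_compact_plane cK.
pose mu := (@lebesgue_measure R \x @lebesgue_measure R)%E.
pose F t := \int[mu]_(p in K) e t p.
have dF : derivable F 0 1.
  exact: (@derivable_under_integral _ _ _ mu e K mK 0 (-1) 1 I0
    (fun t _ => inte t) De' (cst `|C|) (fun=> normr_ge0 C) intC bound).
have F'0 := @differentiation_under_integral _ _ _ mu e K mK 0 (-1) 1 I0
  (fun t _ => inte t) De' (cst `|C|) (fun=> normr_ge0 C) intC bound.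
split; first exact: dF.
rewrite derive1E in F'0; rewrite [LHS]F'0.
by apply: eq_Rintegral => p _; rewrite E1 /e' !mul0r !addr0.
Qed.

(** * Wave maps as solutions of the Euler-Lagrange equations *)

Lemma smooth_on_partial {R : realType} {U : set (R * R)} {g : R * R -> R}
    (w : seq bool) (i : bool) :
  smooth_on U g -> forall p, U p ->
  is_derive p (axis i) (iter_partial w g) (iter_partial (i :: w) g p).
Proof. by move=> sg p Up; have [_ dx dy] := sg w p Up; case: i. Qed.

Lemma smooth_on_continuous {R : realType} {U : set (R * R)} {g : R * R -> R}
    (w : seq bool) :
  smooth_on U g -> forall p, U p -> {for p, continuous (iter_partial w g)}.
Proof. by move=> sg p Up; have [] := sg w p Up. Qed.

(** The flux C(R) g_i is to be integrated by parts against a test function; its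
    divergence term du is spelled out, in order to be compared with the
    Euler-Lagrange equations. *)
Lemma continuous_flux {R : realType} {U : set (R * R)} {C C' : R -> R}
    {Rf g : R * R -> R} {i : bool} :
  (forall z, is_derive z (1 : R) C (C' z)) -> continuous C' ->
  smooth_on U Rf -> smooth_on U g ->
  let du := fun p =>
    C' (Rf p) * iter_partial [:: i] Rf p * iter_partial [:: i] g p
    + C (Rf p) * iter_partial [:: i; i] g p in
  let u := fun p => C (Rf p) * iter_partial [:: i] g p in
  forall p, U p ->
   [/\ is_derive p (axis i) u (du p),
     {for p, continuous u} & {for p, continuous du}].
Proof.
move=> DC cC' sR sg du u p Up.
have cR := smooth_on_continuous [::] sR p Up.
have cC : continuous C := is_derive_continuous DC.
have cCR := cvg_comp _ C cR (cC (Rf p)).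
have cC'R := cvg_comp _ C' cR (cC' (Rf p)).
have cg := smooth_on_continuous [:: i] sg p Up.
split.
- apply: eq_is_derive (is_deriveM
    (is_derive_chain (smooth_on_partial [::] i sR p Up) (DC _))
    (smooth_on_partial [:: i] i sg p Up)) _ _ => //.
  by rewrite /GRing.scale/= /du/=; ring.
- exact: cvgM.
- apply: cvgD.
  + apply: cvgM => //; apply: cvgM => //.
    exact: smooth_on_continuous [:: i] sR p Up.
  + apply: cvgM => //; exact: smooth_on_continuous [:: i; i] sg p Up.
Qed.

Lemma iter_partial_line {R : realType} {U : set (R * R)} {g h : R * R -> R}
    (i : bool) (t : R) {p : R * R} :
  smooth_on U g -> smooth_on setT h -> U p ->
  iter_partial [:: i] (fun q => g q + t * h q) p =
  iter_partial [:: i] g p + t * iter_partial [:: i] h p.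
Proof.
move=> sg sh Up.
have Dg := smooth_on_partial [::] i sg p Up.
have Dh := smooth_on_partial [::] i sh p I.
have D : is_derive p (axis i) (fun q => g q + t * h q)
    (iter_partial [:: i] g p + t * iter_partial [:: i] h p).
  apply: eq_is_derive
    (is_deriveD Dg (is_deriveM (is_derive_cst t p _) Dh)) _ _ => //.
  by rewrite /GRing.scale/=; ring.
by case: i {Dg Dh} D => -[_ <-].
Qed.

(** On a solution of the Euler-Lagrange equations the first variation is the
    divergence of the field with components 2 (A R_x h - B S_x k) and
    - 2 (A R_y h - B S_y k): the two differ by -h times the first equation plus
    2k times the second one. *)
Lemma first_variation_euler_lagrange {R : realType} {A A' B B' : R -> R}
    {r rx ry sx sy rxx ryy sxx syy : R} (h hx hy k kx ky : R) :
  2 * A r * (rxx - ryy) + A' r * (rx ^+ 2 - ry ^+ 2)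
    + B' r * (sx ^+ 2 - sy ^+ 2) = 0 ->
  B r * (sxx - syy) + B' r * (rx * sx - ry * sy) = 0 ->
  first_variation A A' B B' r rx ry sx sy h hx hy kx ky =
  2 * ((((A' r * rx * rx + A r * rxx) * h + A r * rx * hx)
        - ((A' r * ry * ry + A r * ryy) * h + A r * ry * hy))
       - (((B' r * rx * sx + B r * sxx) * k + B r * sx * kx)
          - ((B' r * ry * sy + B r * syy) * k + B r * sy * ky))).
Proof.
set e1 := (X in X = 0); set e2 := (X in _ -> X = 0 -> _) => e10 e20.
apply/eqP; rewrite -subr_eq0; apply/eqP.
transitivity (- h * e1 + 2 * k * e2); last by rewrite e10 e20; ring.
rewrite /first_variation /e1 /e2; ring.
Qed.

(** The equations are the standard wave map system for the metric
    A(R) dR^2 - B(R) dS^2, with the derivatives of the fluxes expanded. *)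
Lemma euler_lagrange_wave_map {R : realType} {f : R * R -> R}
    {A A' B B' : R -> R} {U : set (R * R)} {Rf Sf : R * R -> R} :
  (forall z, is_derive z (1 : R) A (A' z)) ->
  (forall z, is_derive z (1 : R) B (B' z)) ->
  continuous A' -> continuous B' -> open U ->
  smooth_on U Rf -> smooth_on U Sf ->
  (forall p, U p -> 0 < A (Rf p) /\ 0 < B (Rf p)) ->
  (forall p, U p ->
    2 * A (Rf p) * (partial_x (partial_x Rf) p - partial_y (partial_y Rf) p)
    + A' (Rf p) * (partial_x Rf p ^+ 2 - partial_y Rf p ^+ 2)
    + B' (Rf p) * (partial_x Sf p ^+ 2 - partial_y Sf p ^+ 2) = 0) ->
  (forall p, U p ->
    B (Rf p) * (partial_x (partial_x Sf) p - partial_y (partial_y Sf) p)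
    + B' (Rf p) * (partial_x Rf p * partial_x Sf p
                   - partial_y Rf p * partial_y Sf p) = 0) ->
  lorentzian_wave_map f A B U Rf Sf.
Proof.
move=> DA DB cA' cB' oU sR sS AB0 EL1 EL2; split=> //.
move=> K phi psi cK KU sphi spsi supp.
have [phi0 psi0] : (forall p, ~ K p -> phi p = 0) /\
    (forall p, ~ K p -> psi p = 0).
  by split=> p /supp[].
set mu := (@lebesgue_measure R \x @lebesgue_measure R)%E.
have -> : (fun t => energy f A B K (fun p => Rf p + t * phi p)
                                   (fun p => Sf p + t * psi p)) =
    (fun t => \int[mu]_(p in K)
       lagrangian A B (Rf p + t * phi p)
         (partial_x Rf p + t * partial_x phi p)
         (partial_y Rf p + t * partial_y phi p)
         (partial_x Sf p + t * partial_x psi p)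
         (partial_y Sf p + t * partial_y psi p)).
  apply/funext => t; apply: eq_Rintegral => p; rewrite inE => Kp.
  have Up := KU _ Kp.
  rewrite /energy_density mulrC mulrA -expRD subrr expR0 mul1r.
  have line_x g h : smooth_on U g -> smooth_on setT h ->
      partial_x (fun q => g q + t * h q) p = partial_x g p + t * partial_x h p.
    by move=> sg sh; exact: (iter_partial_line false t sg sh Up).
  have line_y g h : smooth_on U g -> smooth_on setT h ->
      partial_y (fun q => g q + t * h q) p = partial_y g p + t * partial_y h p.
    by move=> sg sh; exact: (iter_partial_line true t sg sh Up).
  by rewrite !line_x// !line_y.
have mK : measurable K := measurable_compact_plane cK.
(* The functions of integral zero form a vector space, which contains the
   divergences in x and in y; the first variation belongs to it. *)
pose null F := mu.-integrable K (EFin \o F) /\ \int[mu]_(p in K) F p = 0.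
have nullB F G : null F -> null G -> null (fun p => F p - G p).
  move=> [iF F0] [iG G0]; split.
    by rewrite /comp; under eq_fun do rewrite EFinB; exact: integrableB.
  by rewrite RintegralB// F0 G0 subrr.
have nullZ c F : null F -> null (fun p => c * F p).
  move=> [iF F0]; split.
    by rewrite /comp; under eq_fun do rewrite EFinM; exact: integrableZl.
  by rewrite RintegralZl// F0 mulr0.
pose F (i : bool) (C C' : R -> R) (g h : R * R -> R) p :=
  (C' (Rf p) * iter_partial [:: i] Rf p * iter_partial [:: i] g p
    + C (Rf p) * iter_partial [:: i; i] g p) * h p
  + C (Rf p) * iter_partial [:: i] g p * iter_partial [:: i] h p.
have byparts i C C' g h : (forall z, is_derive z (1 : R) C (C' z)) ->
    continuous C' -> smooth_on U g -> smooth_on setT h ->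
    (forall p, ~ K p -> h p = 0) -> null (F i C C' g h).
  move=> DC cC' sg sh h0.
  have flux p Up := @continuous_flux _ U C C' Rf g i DC cC' sR sg p Up.
  split; last first.
    apply: (integral_by_parts_compact i cK oU KU) => //.
    - by move=> p Up; have [] := flux p Up.
    - by move=> p Up; have [] := flux p Up.
    - by move=> p Up; have [] := flux p Up.
    - by move=> p; exact: (smooth_on_partial [::] i sh p I).
    - by move=> p; exact: (smooth_on_continuous [::] sh p I).
    - by move=> p; exact: (smooth_on_continuous [:: i] sh p I).
  apply: (integrable_compact_plane cK oU KU) => p Up.
  have [_ cu cdu] := flux p Up.
  apply: cvgD; apply: cvgM => //.
  - exact: (smooth_on_continuous [::] sh p I).
  - exact: (smooth_on_continuous [:: i] sh p I).
have := derive_integral_lagrangian DA DB cA' cB' cK oU KU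
  (r := Rf) (rx := partial_x Rf) (ry := partial_y Rf)
  (sx := partial_x Sf) (sy := partial_y Sf)
  (h := phi) (hx := partial_x phi) (hy := partial_y phi)
  (kx := partial_x psi) (ky := partial_y psi).
set X := (X in is_derive _ _ _ X).
suff -> : X = 0.
  apply=> p Up; have cR w := smooth_on_continuous w sR p Up.
    have cS w := smooth_on_continuous w sS p Up; split.
    - exact: (cR [::]).
    - exact: (cR [:: false]).
    - exact: (cR [:: true]).
    - exact: (cS [:: false]).
    - exact: (cS [:: true]).
  have cphi w := smooth_on_continuous w sphi p I.
  have cpsi w := smooth_on_continuous w spsi p I; split.
  - exact: (cphi [::]).
  - exact: (cphi [:: false]).
  - exact: (cphi [:: true]).
  - exact: (cpsi [:: false]).
  - exact: (cpsi [:: true]).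
have nA i := byparts i A A' Rf phi DA cA' sR sphi phi0.
have nB i := byparts i B B' Sf psi DB cB' sS spsi psi0.
have [_ <-] := nullZ 2 _ (nullB _ _ (nullB _ _ (nA false) (nA true))
  (nullB _ _ (nB false) (nB true))).
apply: eq_Rintegral => p; rewrite inE => /KU Up.
exact: first_variation_euler_lagrange (EL1 p Up) (EL2 p Up).
Qed.

(** * Smooth functions from families closed under differentiation *)

(** By induction on the word w, the iterated partial derivative along w
    coincides on U with a member of the family; U being open, this equality of
    functions can be differentiated again. *)
Lemma smooth_on_closed_family {R : realType} {U : set (R * R)}
    {P : (R * R -> R) -> Prop} :
  open U ->
  (forall g, P g -> forall p, U p -> {for p, continuous g}) ->
  (forall g i, P g -> exists2 dg, P dg &
     forall p, U p -> is_derive p (axis i) g (dg p)) ->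
  forall g, P g -> smooth_on U g.
Proof.
move=> oU cP dP g Pg w.
suff [h Ph wh] : exists2 h, P h & forall p, U p -> iter_partial w g p = h p.
  move=> p Up; have nwh : \forall q \near p, h q = iter_partial w g q.
    have : nbhs p U by exact: open_nbhs_nbhs.
    by apply: filterS => q /wh ->.
  have der i : derivable (iter_partial w g) p (axis i).
    have [dh _ /(_ p Up) Dh] := dP h i Ph.
    by have [] := near_eq_is_derive nwh Dh.
  split; [|exact: (der false)|exact: (der true)].
  rewrite /prop_for /continuous_at wh//.
  apply: cvg_trans (cP h Ph p Up).
  exact: near_eq_cvg.
elim: w => [|i w [h Ph wh]]; first by exists g.
have [dh Pdh Dh] := dP h i Ph; exists dh => // p Up.
have nwh : \forall q \near p, h q = iter_partial w g q.
  have : nbhs p U by exact: open_nbhs_nbhs.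
  by apply: filterS => q /wh ->.
by have := near_eq_is_derive nwh (Dh p Up); case: i {Dh} => -[_ <-].
Qed.

Inductive polynomial_in {R : realType} (G : (R * R -> R) -> Prop) :
    (R * R -> R) -> Prop :=
| polynomial_generator g : G g -> polynomial_in G g
| polynomial_constant c : polynomial_in G (fun=> c)
| polynomial_add g h : polynomial_in G g -> polynomial_in G h ->
    polynomial_in G (fun p => g p + h p)
| polynomial_mul g h : polynomial_in G g -> polynomial_in G h ->
    polynomial_in G (fun p => g p * h p).

(** By the Leibniz rule it is enough to differentiate the generators. *)
Lemma smooth_on_polynomial_in {R : realType} {U : set (R * R)}
    {G : (R * R -> R) -> Prop} :
  open U ->
  (forall g, G g -> forall p, U p -> {for p, continuous g}) ->
  (forall g i, G g -> exists2 dg, polynomial_in G dg &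
     forall p, U p -> is_derive p (axis i) g (dg p)) ->
  forall g, polynomial_in G g -> smooth_on U g.
Proof.
move=> oU cG dG; apply: smooth_on_closed_family => //.
  move=> g Pg p Up; elim: Pg => {g} [g Gg|c|g h _ cg _ ch|g h _ cg _ ch].
  - exact: cG.
  - exact: cvg_cst.
  - exact: cvgD.
  - exact: cvgM.
move=> g i; elim=> {g} [g|c|g h Pg [dg Pdg Dg] Ph [dh Pdh Dh]|
                        g h Pg [dg Pdg Dg] Ph [dh Pdh Dh]].
- exact: dG.
- exists (fun=> 0); first exact: polynomial_constant.
  by move=> p _; exact: is_derive_cst.
- exists (fun p => dg p + dh p); first exact: polynomial_add.
  by move=> p Up; exact: is_deriveD (Dg p Up) (Dh p Up).
- exists (fun p => g p * dh p + h p * dg p).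
    by apply: polynomial_add; exact: polynomial_mul.
  by move=> p Up; exact: is_deriveM (Dg p Up) (Dh p Up).
Qed.

Lemma cosh_gt0 {R : realType} (x : R) : 0 < cosh x.
Proof. by rewrite /cosh divr_gt0 ?addr_gt0 ?expR_gt0. Qed.

Lemma cosh2_sinh2 {R : realType} (x : R) : cosh x ^+ 2 = 1 + sinh x ^+ 2.
Proof.
have : expR x * expR (- x) = 1 by rewrite -expRD subrr expR0.
rewrite /cosh /sinh; move: (expR x) (expR (- x)) => u v uv.
by transitivity (u * v + ((u - v) / 2) ^+ 2); [field|rewrite uv].
Qed.

Lemma is_derive_inv {R : realType} {V : normedModType R} {g : V -> R} {x v : V}
    {dg : R} :
  g x != 0 -> is_derive x v g dg ->
  is_derive x v (fun z => (g z)^-1) (- dg / g x ^+ 2).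
Proof.
move=> gx [Dg <-]; split; first exact: derivableV.
by rewrite deriveV// /GRing.scale/= mulNr mulrC mulNr.
Qed.

Lemma is_derive_arctanh {R : realType} {x : R} :
  `|x| < 1 -> is_derive x (1 : R) arctanh (1 - x ^+ 2)^-1.
Proof.
rewrite ltr_norml => /andP[x1 x2].
have p1 : 0 < 1 + x by rewrite -ltrBlDl sub0r.
have p2 : 0 < 1 - x by rewrite subr_gt0.
have Dn : is_derive x (1 : R) (fun z => 1 + z) 1.
  by apply: eq_is_derive (is_deriveD (is_derive_cst (1 : R) x 1)
    (is_derive_id x 1)) _ _ => //; rewrite add0r.
have Dd : is_derive x (1 : R) (fun z => (1 - z)^-1) ((1 - x)^-1 ^+ 2).
  have D0 : is_derive x (1 : R) (fun z => 1 - z) (-1).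
    by apply: eq_is_derive (is_deriveB (is_derive_cst (1 : R) x 1)
      (is_derive_id x 1)) _ _ => //; rewrite sub0r.
  apply: eq_is_derive
    (is_derive_inv (g := fun z : R => 1 - z) (lt0r_neq0 p2) D0) _ _ => //.
  by field; exact: lt0r_neq0.
pose g (z : R) := (1 + z) / (1 - z).
have Dg : is_derive x (1 : R) g _ := is_deriveM Dn Dd.
have Dl : is_derive (g x) (1 : R) (@ln R) (g x)^-1.
  by apply: is_derive1_ln; exact: divr_gt0.
apply: eq_is_derive (is_deriveM (is_derive_chain Dg Dl)
  (is_derive_cst (2^-1 : R) x 1)) _ _ => //.
rewrite /GRing.scale/= /g; field.
have -> : 1 - x ^+ 2 = (1 - x) * (1 + x) by ring.
by rewrite mulf_neq0 ?lt0r_neq0.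
Qed.

(** * The explicit map and its domain *)

Definition phase {R : realType} (omega a b : R) (p : R * R) : R :=
  omega * (a * p.2 - b * p.1).

(** The i-th partial derivative of a y - b x. *)
Definition phase_grad {R : realType} (a b : R) (i : bool) : R :=
  if i then a else - b.

(** The first component of the map; the parameter omega is left free. *)
Definition colatitude {R : realType} (theta omega a b : R) (p : R * R) : R :=
  acos (cosh theta * sin (phase omega a b p)).

(** The second component of the map, with a free slope k. *)
Definition longitude {R : realType} (theta omega a b k : R) (p : R * R) : R :=
  a * p.1 + b * p.2 + k * (a * p.2 - b * p.1)
  + arctanh (sinh theta * tan (phase omega a b p)).

(** The domain of definition of the map: [regular_domain_bounds] shows that the
    argument of arccos is then in ]-1, 1[, where arccos is differentiable. *)
Definition regular_domain {R : realType} (theta omega a b : R) :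
    set (R * R) :=
  [set p | cos (phase omega a b p) != 0 /\
           `|sinh theta * tan (phase omega a b p)| < 1].

Lemma is_derive_linear_form {R : realType} (u v : R) (i : bool) (p : R * R) :
  is_derive p (axis i) (fun q => u * q.1 + v * q.2) (if i then v else u).
Proof.
have aff (c d x : R) : is_derive x (1 : R) (fun y => c * y + d) c.
  apply: eq_is_derive (is_deriveD (is_deriveM (is_derive_cst c x 1)
    (is_derive_id x 1)) (is_derive_cst d x 1)) _ _ => //.
  by rewrite /GRing.scale/=; ring.
case: i; last by apply/is_derive_fst;
  exact: eq_is_derive (aff u (v * p.2) p.1) _ _.
apply/is_derive_snd; apply: eq_is_derive (aff v (u * p.1) p.2) _ _ => // y /=.
by rewrite addrC.
Qed.

Lemma is_derive_phase {R : realType} (omega a b : R) (i : bool) (p : R * R) :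
  is_derive p (axis i) (phase omega a b) (omega * phase_grad a b i).
Proof.
apply: eq_is_derive (is_derive_linear_form (- (omega * b)) (omega * a) i p) _ _.
  by move=> q; rewrite /phase; ring.
by case: i; rewrite /phase_grad; ring.
Qed.

Lemma continuous_phase {R : realType} {omega a b : R} :
  continuous (phase omega a b : R * R -> R).
Proof.
move=> p; apply: cvgM; first exact: cvg_cst.
by apply: cvgB; apply: cvgM; [exact: cvg_cst|apply: cvg_snd|
  exact: cvg_cst|apply: cvg_fst].
Qed.

(** With s = sin^2 and 1 - s = cos^2, the inequality sinh^2 s / (1 - s) < 1 is
    equivalent to (1 + sinh^2) s < 1, and 1 + sinh^2 = cosh^2. *)
Lemma regular_domain_bounds {R : realType} {theta omega a b : R} {p : R * R} :
  regular_domain theta omega a b p ->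
  -1 < cosh theta * sin (phase omega a b p) < 1.
Proof.
move=> [/= c0]; set x := phase _ _ _ _ in c0 *; rewrite /tan => t1.
have sq1 (z : R) : (`|z| < 1) = (z ^+ 2 < 1).
  by rewrite -(@expr_lt1 _ 2) ?normr_ge0// real_normK ?num_real.
rewrite -ltr_norml sq1; move: t1; rewrite sq1.
move: (cosh2_sinh2 theta); move: (cosh theta) (sinh theta) => ch sh chsh.
rewrite !exprMn exprVn chsh mulrA ltr_pdivrMr ?mul1r ?exprn_even_gt0//.
have := cos2Dsin2 x; set s := sin x ^+ 2; set k := cos x ^+ 2.
by move=> sk1; rewrite mulrDl mul1r -sk1 addrC ltrD2r.
Qed.

Lemma sin_colatitude {R : realType} {theta omega a b : R} {p : R * R} :
  regular_domain theta omega a b p ->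
  [/\ 0 < sin (colatitude theta omega a b p),
      sin (colatitude theta omega a b p) ^+ 2 =
        1 - cosh theta ^+ 2 * sin (phase omega a b p) ^+ 2 &
      cos (colatitude theta omega a b p) =
        cosh theta * sin (phase omega a b p)].
Proof.
move=> /regular_domain_bounds /andP[x1 x2]; rewrite /colatitude.
have x12 : -1 <= cosh theta * sin (phase omega a b p) <= 1 by rewrite !ltW.
have sq : 0 < 1 - (cosh theta * sin (phase omega a b p)) ^+ 2.
  rewrite subr_gt0 -real_normK ?num_real// expr_lt1//.
  by rewrite ltr_norml x1.
split.
- by rewrite sin_acos// sqrtr_gt0.
- by rewrite sin_acos// sqr_sqrtr ?ltW// (exprMn _ (cosh theta)).
- by rewrite acosK// in_itv/=.
Qed.

(** * Derivatives of the explicit map *)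

Lemma is_derive_sin_phase {R : realType} (omega a b : R) i p :
  is_derive p (axis i) (fun q => sin (phase omega a b q))
    (omega * cos (phase omega a b p) * phase_grad a b i).
Proof.
apply: eq_is_derive (is_derive_chain (is_derive_phase omega a b i p)
  (is_derive_sin _)) _ _ => //.
by ring.
Qed.

Lemma is_derive_cos_phase {R : realType} (omega a b : R) i p :
  is_derive p (axis i) (fun q => cos (phase omega a b q))
    (- omega * sin (phase omega a b p) * phase_grad a b i).
Proof.
apply: eq_is_derive (is_derive_chain (is_derive_phase omega a b i p)
  (is_derive_cos _)) _ _ => //.
by ring.
Qed.

(** The derivative of the colatitude with respect to a y - b x. *)
Definition colatitude_speed {R : realType} (theta omega a b : R) (p : R * R) :=
  - (omega * cosh theta * cos (phase omega a b p)
     * (sin (colatitude theta omega a b p))^-1).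

(** The derivative of the longitude with respect to a y - b x, apart from the
    contribution of a x + b y. *)
Definition longitude_speed {R : realType} (theta omega a b k : R)
    (p : R * R) :=
  k + omega * sinh theta * (sin (colatitude theta omega a b p))^-1 ^+ 2.

Lemma is_derive_colatitude {R : realType} {theta omega a b : R} i {p} :
  regular_domain theta omega a b p ->
  is_derive p (axis i) (colatitude theta omega a b)
    (colatitude_speed theta omega a b p * phase_grad a b i).
Proof.
move=> Wp; have x1 := regular_domain_bounds Wp.
have x12 : -1 <= cosh theta * sin (phase omega a b p) <= 1.
  by case/andP: x1 => *; rewrite !ltW.
have Ds : is_derive p (axis i) (fun q => cosh theta * sin (phase omega a b q))
    (cosh theta * (omega * cos (phase omega a b p) * phase_grad a b i)).
  apply: eq_is_derive (is_deriveM (is_derive_cst (cosh theta) p _)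
    (is_derive_sin_phase omega a b i p)) _ _ => //.
  by rewrite /GRing.scale/= mulr0 addr0.
apply: eq_is_derive (is_derive_chain Ds (is_derive1_acos x1)) _ _ => //.
by rewrite -sin_acos// /colatitude_speed /colatitude; ring.
Qed.

(** The derivative is a polynomial in the sine and cosine of the phase and in
    1 / sin R itself, which is what makes the family of
    [solution_generator] closed under differentiation. *)
Lemma is_derive_inv_sin_colatitude {R : realType} {theta omega a b : R} i {p} :
  regular_domain theta omega a b p ->
  is_derive p (axis i) (fun q => (sin (colatitude theta omega a b q))^-1)
    (omega * cosh theta ^+ 2 * sin (phase omega a b p)
     * cos (phase omega a b p) * (sin (colatitude theta omega a b p))^-1 ^+ 3
     * phase_grad a b i).
Proof.
move=> Wp; have [s0 _ cE] := sin_colatitude Wp.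
have Ds := is_derive_chain (is_derive_colatitude i Wp) (is_derive_sin _).
apply: eq_is_derive (is_derive_inv (lt0r_neq0 s0) Ds) _ _ => //.
rewrite cE /colatitude_speed; move: s0 => /lt0r_neq0.
by set sg := sin (colatitude _ _ _ _ _) => s0; field.
Qed.

(** The derivative of arctanh brings in 1 - sinh^2 tan^2, whose product with
    cos^2 is 1 - cosh^2 sin^2 = sin^2 R. *)
Lemma is_derive_longitude {R : realType} {theta omega a b : R} (k : R) i {p} :
  regular_domain theta omega a b p ->
  is_derive p (axis i) (longitude theta omega a b k)
    ((if i then b else a) + longitude_speed theta omega a b k p
       * phase_grad a b i).
Proof.
move=> Wp; have [c0 t1] := Wp; have [s0 s2 _] := sin_colatitude Wp.
have Dt : is_derive p (axis i) (fun q => sinh theta * tan (phase omega a b q))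
    (sinh theta * (cos (phase omega a b p) ^- 2 * (omega * phase_grad a b i))).
  apply: eq_is_derive (is_deriveM (is_derive_cst (sinh theta) p _)
    (is_derive_chain (is_derive_phase omega a b i p) (is_derive_tan c0)))
    _ _ => //.
  by rewrite /GRing.scale/= mulr0 addr0.
have Dl := is_derive_linear_form (a - k * b) (b + k * a) i p.
have Da := is_derive_chain Dt (is_derive_arctanh t1).
apply: eq_is_derive (is_deriveD Dl Da) _ _.
  by move=> q; rewrite /longitude /=; congr (_ + _); ring.
have E : 1 - (sinh theta * tan (phase omega a b p)) ^+ 2 =
    sin (colatitude theta omega a b p) ^+ 2 / cos (phase omega a b p) ^+ 2.
  rewrite s2 /tan; have := cos2Dsin2 (phase omega a b p).
  move: c0 (cosh2_sinh2 theta); move: (cosh _) (sinh _) (cos _) (sin _).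
  move=> ch sh co si c0 -> cs.
  apply: (mulIf (expf_neq0 2 c0)); rewrite divfK ?expf_neq0//.
  transitivity (co ^+ 2 - sh ^+ 2 * si ^+ 2); first by field.
  have -> : co ^+ 2 = 1 - si ^+ 2 by rewrite -cs addrK.
  by ring.
rewrite E /longitude_speed; move: s0 => /lt0r_neq0.
move: c0; set sg := sin (colatitude _ _ _ _ _); set co := cos _ => c0 s0.
by case: i {Dt Dl Da}; rewrite /phase_grad; field; rewrite ?c0 ?s0.
Qed.

(** The identity cosh^2 theta cos^2 alpha = sinh^2 theta + sin^2 R, alpha being
    the phase, turns the two terms of the product rule into a single one. *)
Lemma is_derive_colatitude_speed {R : realType} {theta omega a b : R} i {p} :
  regular_domain theta omega a b p ->
  is_derive p (axis i) (colatitude_speed theta omega a b)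
    (- (omega ^+ 2 * cosh theta * sinh theta ^+ 2 * sin (phase omega a b p)
        * (sin (colatitude theta omega a b p))^-1 ^+ 3) * phase_grad a b i).
Proof.
move=> Wp; have [s0 s2 _] := sin_colatitude Wp.
have D := is_deriveM (is_derive_cos_phase omega a b i p)
  (is_derive_inv_sin_colatitude i Wp).
apply: eq_is_derive (is_deriveM (is_derive_cst (- (omega * cosh theta)) p _) D)
  _ _.
  by move=> q; rewrite /colatitude_speed /= !mulNr mulrA.
rewrite /GRing.scale/= mulr0 addr0.
have := cos2Dsin2 (phase omega a b p).
move: s0 s2 (cosh2_sinh2 theta) => /lt0r_neq0.
set sg := sin (colatitude _ _ _ _ _).
move: (cosh _) (sinh _) (cos _) (sin (phase _ _ _ _)).
move=> ch sh co si s0 s2 ch2 cs.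
have e : ch ^+ 2 * co ^+ 2 = sh ^+ 2 + sg ^+ 2.
  by rewrite s2 -[co ^+ 2](addrK (si ^+ 2)) cs ch2; ring.
apply/eqP; rewrite -subr_eq0; apply/eqP.
transitivity (- omega ^+ 2 * ch * si * sg^-1 ^+ 3 * phase_grad a b i
  * (ch ^+ 2 * co ^+ 2 - (sh ^+ 2 + sg ^+ 2))); first by field.
by rewrite e subrr mulr0.
Qed.

Lemma is_derive_longitude_speed {R : realType} {theta omega a b : R} (k : R)
    i {p} :
  regular_domain theta omega a b p ->
  is_derive p (axis i) (longitude_speed theta omega a b k)
    (2 * omega ^+ 2 * sinh theta * cosh theta ^+ 2 * sin (phase omega a b p)
        * cos (phase omega a b p)
        * (sin (colatitude theta omega a b p))^-1 ^+ 4 * phase_grad a b i).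
Proof.
move=> Wp.
have D := is_deriveX 2 (is_derive_inv_sin_colatitude i Wp).
apply: eq_is_derive (is_deriveD (is_derive_cst k p _)
  (is_deriveM (is_derive_cst (omega * sinh theta) p _) D)) _ _ => //.
by rewrite /GRing.scale/=; ring.
Qed.

(** * Smoothness of the explicit map *)

Lemma polynomial_exp {R : realType} {G : (R * R -> R) -> Prop} g n :
  polynomial_in G g -> polynomial_in G (fun p => g p ^+ n).
Proof.
move=> Pg; elim: n => [|n IHn]; first exact: (polynomial_constant G 1).
have -> : (fun p => g p ^+ n.+1) = (fun p => g p * g p ^+ n).
  by apply/funext => p; rewrite exprS.
exact: polynomial_mul.
Qed.

Lemma polynomial_opp {R : realType} {G : (R * R -> R) -> Prop} g :
  polynomial_in G g -> polynomial_in G (fun p => - g p).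
Proof.
move=> Pg; have -> : (fun p => - g p) = (fun p => -1 * g p).
  by apply/funext => p; rewrite mulN1r.
by apply: polynomial_mul => //; exact: polynomial_constant.
Qed.

(** Besides the two components of the map, the functions in which their
    derivatives are polynomials. *)
Inductive solution_generator {R : realType} (theta omega a b k : R) :
    (R * R -> R) -> Prop :=
| generator_colatitude :
    solution_generator theta omega a b k (colatitude theta omega a b)
| generator_longitude :
    solution_generator theta omega a b k (longitude theta omega a b k)
| generator_sin :
    solution_generator theta omega a b k (fun p => sin (phase omega a b p))
| generator_cos :
    solution_generator theta omega a b k (fun p => cos (phase omega a b p))
| generator_inv_sin :
    solution_generator theta omega a b k
      (fun p => (sin (colatitude theta omega a b p))^-1).

Lemma continuous_phase_comp {R : realType} {omega a b : R} (F : R -> R)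
    (p : R * R) :
  {for phase omega a b p, continuous F} ->
  {for p, continuous (fun q => F (phase omega a b q))}.
Proof.
have cp : {for p, continuous (phase omega a b)} := continuous_phase p.
exact: continuous_comp cp.
Qed.

Lemma continuous_tan_phase {R : realType} {theta omega a b : R} {p : R * R} :
  cos (phase omega a b p) != 0 ->
  {for p, continuous (fun q => sinh theta * tan (phase omega a b q))}.
Proof.
move=> c0; apply: cvgM; first exact: cvg_cst.
have ct : {for phase omega a b p, continuous (@tan R)}.
  by apply: differentiable_continuous; apply/derivable1_diffP;
    have [] := is_derive_tan c0.
exact: continuous_phase_comp tan p ct.
Qed.

Lemma open_regular_domain {R : realType} (theta omega a b : R) :
  open (regular_domain theta omega a b).
Proof.
have oC : open [set p | cos (phase omega a b p) != 0].
  have -> : [set p | cos (phase omega a b p) != 0] =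
      setT `&` (fun p => cos (phase omega a b p)) @^-1` [set~ 0].
    by apply/seteqP; split=> p /= => [/eqP|[_ /eqP]].
  apply: open_continuous_preimage; first exact: openT.
    move=> p _; apply: continuous_phase_comp; exact: continuous_cos.
  by apply: closed_openC; exact: closed_eq.
have -> : regular_domain theta omega a b =
    [set p | cos (phase omega a b p) != 0] `&`
    (fun p => sinh theta * tan (phase omega a b p)) @^-1` (ball 0 1).
  apply/seteqP; split=> p.
    by case=> /= c0 t1; split => //; rewrite /= -ball_normE/= sub0r normrN.
  by case=> /= c0; rewrite -ball_normE/= sub0r normrN.
apply: open_continuous_preimage => //; last exact: ball_open.
by move=> p; exact: continuous_tan_phase.
Qed.

Lemma continuous_colatitude {R : realType} {theta omega a b : R} {p : R * R} :
  regular_domain theta omega a b p ->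
  {for p, continuous (colatitude theta omega a b)}.
Proof.
move=> /regular_domain_bounds x1.
have cs : {for p, continuous (fun q => cosh theta * sin (phase omega a b q))}.
  apply: cvgM; first exact: cvg_cst.
  apply: continuous_phase_comp; exact: continuous_sin.
exact: continuous_comp cs (continuous_acos x1).
Qed.

Lemma continuous_generator {R : realType} {theta omega a b k : R} {g} :
  solution_generator theta omega a b k g ->
  forall p, regular_domain theta omega a b p -> {for p, continuous g}.
Proof.
case=> p Wp.
- exact: continuous_colatitude.
- have [c0 t1] := Wp; apply: cvgD.
    apply: cvgD; first apply: cvgD.
    + by apply: cvgM; [exact: cvg_cst|apply: cvg_fst].
    + by apply: cvgM; [exact: cvg_cst|apply: cvg_snd].
    + apply: cvgM; first exact: cvg_cst.
      by apply: cvgB; apply: cvgM; [exact: cvg_cst|apply: cvg_snd|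
        exact: cvg_cst|apply: cvg_fst].
  have ca : {for sinh theta * tan (phase omega a b p),
      continuous (@arctanh R)}.
    by apply: differentiable_continuous; apply/derivable1_diffP;
      have [] := is_derive_arctanh t1.
  exact: continuous_comp (continuous_tan_phase c0) ca.
- apply: continuous_phase_comp; exact: continuous_sin.
- apply: continuous_phase_comp; exact: continuous_cos.
- have [s0 _ _] := sin_colatitude Wp; apply: cvgV; first exact: lt0r_neq0.
  apply: (continuous_comp (continuous_colatitude Wp)); exact: continuous_sin.
Qed.

Lemma derivative_generator {R : realType} {theta omega a b k : R} {g} i :
  solution_generator theta omega a b k g ->
  exists2 dg, polynomial_in (solution_generator theta omega a b k) dg &
    forall p, regular_domain theta omega a b p ->
      is_derive p (axis i) g (dg p).
Proof.
pose P := polynomial_in (solution_generator theta omega a b k).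
have pc c : P (fun=> c) by exact: polynomial_constant.
have ps : P (fun p => sin (phase omega a b p)).
  by apply: polynomial_generator; exact: generator_sin.
have pco : P (fun p => cos (phase omega a b p)).
  by apply: polynomial_generator; exact: generator_cos.
have pq : P (fun p => (sin (colatitude theta omega a b p))^-1).
  by apply: polynomial_generator; exact: generator_inv_sin.
case; eexists; try by move=> p; first [exact: is_derive_colatitude
  | exact: is_derive_longitude | exact: is_derive_inv_sin_colatitude
  | move=> _; exact: is_derive_sin_phase
  | move=> _; exact: is_derive_cos_phase].
all: rewrite /colatitude_speed /longitude_speed.
all: repeat first [exact: pc | exact: ps | exact: pco | exact: pq
  | apply: polynomial_opp | apply: polynomial_exp | apply: polynomial_add
  | apply: polynomial_mul].
Qed.

Lemma smooth_on_regular_domain {R : realType} (theta omega a b k : R) g :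
  solution_generator theta omega a b k g ->
  smooth_on (regular_domain theta omega a b) g.
Proof.
move=> Gg; apply: (@smooth_on_polynomial_in _ _
  (solution_generator theta omega a b k)).
- exact: open_regular_domain.
- by move=> h; exact: continuous_generator.
- by move=> h i; exact: derivative_generator.
- exact: polynomial_generator.
Qed.

(** The formula for the first derivative must hold on an open set in order to be
    differentiated once more. *)
Lemma iter_partial_of_derive {R : realType} {U : set (R * R)}
    {g dg : R * R -> R} {i : bool} {ddg : R} {p : R * R} :
  open U -> U p -> (forall q, U q -> is_derive q (axis i) g (dg q)) ->
  is_derive p (axis i) dg ddg ->
  iter_partial [:: i] g p = dg p /\ iter_partial [:: i; i] g p = ddg.
Proof.
move=> oU Up Dg Ddg.
have E q : U q -> iter_partial [:: i] g q = dg q.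
  by move=> /Dg; case: (i) => -[_ <-].
have ndg : \forall q \near p, dg q = iter_partial [:: i] g q.
  have : nbhs p U by exact: open_nbhs_nbhs.
  by apply: filterS => q /E.
split; first exact: E.
by have := near_eq_is_derive ndg Ddg; case: (i) => -[_ <-].
Qed.

Lemma colatitude_partials {R : realType} {theta omega a b : R} i {p} :
  regular_domain theta omega a b p ->
  iter_partial [:: i] (colatitude theta omega a b) p =
    colatitude_speed theta omega a b p * phase_grad a b i /\
  iter_partial [:: i; i] (colatitude theta omega a b) p =
    - (omega ^+ 2 * cosh theta * sinh theta ^+ 2 * sin (phase omega a b p)
       * (sin (colatitude theta omega a b p))^-1 ^+ 3) * phase_grad a b i ^+ 2.
Proof.
move=> Wp; apply: (iter_partial_of_derive
  (dg := fun q => colatitude_speed theta omega a b q * phase_grad a b i)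
  (open_regular_domain theta omega a b) Wp).
  by move=> q; exact: is_derive_colatitude.
apply: eq_is_derive (is_deriveM (is_derive_colatitude_speed i Wp)
  (is_derive_cst (phase_grad a b i) p _)) _ _ => //.
by rewrite /GRing.scale/=; ring.
Qed.

Lemma longitude_partials {R : realType} {theta omega a b : R} (k : R) i {p} :
  regular_domain theta omega a b p ->
  iter_partial [:: i] (longitude theta omega a b k) p =
    (if i then b else a)
    + longitude_speed theta omega a b k p * phase_grad a b i /\
  iter_partial [:: i; i] (longitude theta omega a b k) p =
    2 * omega ^+ 2 * sinh theta * cosh theta ^+ 2 * sin (phase omega a b p)
    * cos (phase omega a b p)
    * (sin (colatitude theta omega a b p))^-1 ^+ 4 * phase_grad a b i ^+ 2.
Proof.
move=> Wp; apply: (iter_partial_of_derive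
  (dg := fun q => (if i then b else a)
    + longitude_speed theta omega a b k q * phase_grad a b i)
  (open_regular_domain theta omega a b) Wp).
  by move=> q; exact: is_derive_longitude.
apply: eq_is_derive (is_deriveD (is_derive_cst (if i then b else a) p _)
  (is_deriveM (is_derive_longitude_speed k i Wp)
  (is_derive_cst (phase_grad a b i) p _))) _ _ => //.
by rewrite /GRing.scale/=; ring.
Qed.

(** * The Euler-Lagrange equations for the explicit map *)

(** The slope of S in the direction of a y - b x cancels in the determinant. *)
Lemma jacobian_solution {R : realType} {theta omega a b : R} (k : R) {p} :
  regular_domain theta omega a b p ->
  jacobian_det (colatitude theta omega a b) (longitude theta omega a b k) p =
  - (colatitude_speed theta omega a b p * (a ^+ 2 + b ^+ 2)).
Proof.
move=> Wp; rewrite /jacobian_det.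
have [] := colatitude_partials false Wp; rewrite /= => -> _.
have [] := colatitude_partials true Wp; rewrite /= => -> _.
have [] := longitude_partials k false Wp; rewrite /= => -> _.
have [] := longitude_partials k true Wp; rewrite /= => -> _.
ring.
Qed.

Lemma colatitude_speed_neq0 {R : realType} {theta omega a b : R} {p} :
  omega != 0 -> regular_domain theta omega a b p ->
  colatitude_speed theta omega a b p != 0.
Proof.
move=> w0 Wp; have [s0 _ _] := sin_colatitude Wp; have [c0 _] := Wp.
have ch0 : cosh theta != 0 by apply: lt0r_neq0; exact: cosh_gt0.
have si0 := invr_neq0 (lt0r_neq0 s0).
rewrite /colatitude_speed oppr_eq0.
exact: (mulf_neq0 (mulf_neq0 (mulf_neq0 w0 ch0) c0) si0).
Qed.

(** Multiplied by R', this is the conservation law for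
    A R'^2 - omega^2 (c^2 - 1) B - omega^2 sinh^2 theta / B.  The hypotheses
    on k and omega enter through S_x^2 - S_y^2, which they reduce to
    (b^2 - a^2) (h'^2 - (c^2 - 1) omega^2). *)
Lemma solution_euler_lagrange_colatitude {R : realType}
    {c theta omega a b k : R} {p : R * R} :
  (b ^+ 2 - a ^+ 2) * k = 2 * a * b ->
  (c ^+ 2 - 1) * omega ^+ 2 = 1 + k ^+ 2 ->
  regular_domain theta omega a b p ->
  let Rf := colatitude theta omega a b in
  let Sf := longitude theta omega a b k in
  2 * (c ^+ 2 * sin (Rf p) ^+ 2 + cos (Rf p) ^+ 2)
    * (partial_x (partial_x Rf) p - partial_y (partial_y Rf) p)
  + 2 * (c ^+ 2 - 1) * sin (Rf p) * cos (Rf p)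
    * (partial_x Rf p ^+ 2 - partial_y Rf p ^+ 2)
  + 2 * sin (Rf p) * cos (Rf p)
    * (partial_x Sf p ^+ 2 - partial_y Sf p ^+ 2) = 0.
Proof.
move=> dk wk Wp Rf Sf.
have [] := colatitude_partials false Wp; rewrite /= => -> ->.
have [] := colatitude_partials true Wp; rewrite /= => -> ->.
have [] := longitude_partials k false Wp; rewrite /= => -> _.
have [] := longitude_partials k true Wp; rewrite /= => -> _.
have [s0 s2 cE] := sin_colatitude Wp.
rewrite cE /colatitude_speed /longitude_speed -/Rf in s0 s2 *.
have := cos2Dsin2 (phase omega a b p); move: (cosh2_sinh2 theta) s0 s2.
move: (cosh theta) (sinh theta) (sin (Rf p)) => ch sh sg.
move: (cos _) (sin _) => co si ch2 /lt0r_neq0 s0 s2 cs.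
(* R'^2 = omega^2 (sinh^2 theta + B) / B, up to the factor omega^2 / B. *)
have r2 : ch ^+ 2 * co ^+ 2 = sh ^+ 2 + sg ^+ 2.
  have -> : co ^+ 2 = 1 - si ^+ 2 by rewrite -cs addrK.
  by rewrite s2 ch2; ring.
have A1 : c ^+ 2 * sg ^+ 2 + (ch * si) ^+ 2 = 1 + (c ^+ 2 - 1) * sg ^+ 2.
  by rewrite s2; ring.
set h := omega * sh * sg^-1 ^+ 2.
have S2 : (a + (k + h) * - b) ^+ 2 - (b + (k + h) * a) ^+ 2 =
    (b ^+ 2 - a ^+ 2) * (h ^+ 2 - (c ^+ 2 - 1) * omega ^+ 2).
  transitivity ((b ^+ 2 - a ^+ 2) * (h ^+ 2 - 1 + k ^+ 2 + 2 * k * h)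
    - 2 * (2 * a * b) * (k + h)); first by ring.
  by rewrite -dk wk; ring.
rewrite A1 S2 /h.
(* What remains is proportional to the identity r2. *)
transitivity (2 * (b ^+ 2 - a ^+ 2) * ch * si * omega ^+ 2 * (c ^+ 2 - 1)
  * sg^-1 * (ch ^+ 2 * co ^+ 2 - (sh ^+ 2 + sg ^+ 2))); last first.
  by rewrite r2 subrr mulr0.
by rewrite /phase_grad; field.
Qed.

(** The choice of k removes the mixed term of R_x S_x - R_y S_y; what is left is
    the constancy of B h' = omega sinh theta. *)
Lemma solution_euler_lagrange_longitude {R : realType}
    {theta omega a b k : R} {p : R * R} :
  (b ^+ 2 - a ^+ 2) * k = 2 * a * b ->
  regular_domain theta omega a b p ->
  let Rf := colatitude theta omega a b in
  let Sf := longitude theta omega a b k in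
  sin (Rf p) ^+ 2 * (partial_x (partial_x Sf) p - partial_y (partial_y Sf) p)
  + 2 * sin (Rf p) * cos (Rf p)
    * (partial_x Rf p * partial_x Sf p - partial_y Rf p * partial_y Sf p) = 0.
Proof.
move=> dk Wp Rf Sf.
have [] := colatitude_partials false Wp; rewrite /= => -> _.
have [] := colatitude_partials true Wp; rewrite /= => -> _.
have [] := longitude_partials k false Wp; rewrite /= => -> ->.
have [] := longitude_partials k true Wp; rewrite /= => -> ->.
have [s0 s2 cE] := sin_colatitude Wp.
rewrite cE /colatitude_speed /longitude_speed -/Rf in s0 *.
move: s0; move: (cosh theta) (sinh theta) (sin (Rf p)) => ch sh sg.
move: (cos _) (sin _) => co si /lt0r_neq0 s0.
transitivity (- (2 * ch ^+ 2 * si * omega * co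
  * ((b ^+ 2 - a ^+ 2) * k - 2 * a * b))); last by rewrite dk subrr mulr0 oppr0.
by rewrite /phase_grad; field.
Qed.

Theorem proposition8 (R : realType) (c theta a b : R)
    (M : set (R * R)) (f : R * R -> R)
    (c_gt1 : 1 < c) (ab_neq0 : a * b != 0) (a2_neq_b2 : a ^+ 2 != b ^+ 2)
    (M_open : open M) (f_smooth : smooth_on M f) :
  let A := fun r : R => c ^+ 2 * sin r ^+ 2 + cos r ^+ 2 in
  let B := fun r : R => sin r ^+ 2 in
  let omega := (a ^+ 2 + b ^+ 2) / (b ^+ 2 - a ^+ 2)
               * (1 / Num.sqrt (c ^+ 2 - 1)) in
  let angle := fun p : R * R => omega * (a * p.2 - b * p.1) in
  let Rf := fun p : R * R => acos (cosh theta * sin (angle p)) in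
  let Sf := fun p : R * R =>
    a * p.1 + b * p.2
    + 2 * a * b / (b ^+ 2 - a ^+ 2) * (a * p.2 - b * p.1)
    + arctanh (sinh theta * tan (angle p)) in
  let U := [set p : R * R |
    [/\ M p, (* domain of definition of arccos, tan and arctanh *)
        `|cosh theta * sin (angle p)| <= 1,
        cos (angle p) != 0,
        `|sinh theta * tan (angle p)| < 1
      & jacobian_det Rf Sf p != 0]] in
  open U /\ lorentzian_wave_map f A B U Rf Sf.
Proof.
move=> A B omega angle Rf Sf U.
pose k := 2 * a * b / (b ^+ 2 - a ^+ 2).
have d0 : b ^+ 2 - a ^+ 2 != 0 by rewrite subr_eq0 eq_sym.
have c1 : 0 < c ^+ 2 - 1 by rewrite subr_gt0 expr_gt1// ltW// (lt_trans ltr01).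
have n0 : a ^+ 2 + b ^+ 2 != 0.
  rewrite lt0r_neq0// ltr_pwDl ?sqr_ge0//.
  by move: ab_neq0; rewrite mulf_eq0 negb_or => /andP[a0 _];
    rewrite exprn_even_gt0.
have omega0 : omega != 0.
  rewrite mulf_neq0// ?mul1r ?invr_eq0 ?sqrtr_eq0 -?ltNge//.
  by rewrite mulf_neq0// invr_eq0.
have dk : (b ^+ 2 - a ^+ 2) * k = 2 * a * b by rewrite /k; field.
have wk : (c ^+ 2 - 1) * omega ^+ 2 = 1 + k ^+ 2.
  have sq : Num.sqrt (c ^+ 2 - 1) ^+ 2 = c ^+ 2 - 1 by rewrite sqr_sqrtr// ltW.
  have sq0 : Num.sqrt (c ^+ 2 - 1) != 0 by rewrite sqrtr_eq0 -ltNge.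
  rewrite -{1}sq /omega /k; move: (Num.sqrt _) sq0 => s s0.
  by field; rewrite ?d0.
have WU : U = M `&` regular_domain theta omega a b.
  apply/seteqP; split=> p; first by case=> Mp _ c0 t1 _.
  case=> Mp Wp; have [c0 t1] := Wp; split => //.
    have /andP[x1 x2] := regular_domain_bounds Wp.
    by rewrite ler_norml !ltW.
  rewrite (jacobian_solution k Wp) oppr_eq0 mulf_neq0//.
  exact: colatitude_speed_neq0.
have UW p : U p -> regular_domain theta omega a b p by rewrite WU => -[].
have oU : open U by rewrite WU; apply: openI => //; exact: open_regular_domain.
have smoothU g : solution_generator theta omega a b k g -> smooth_on U g.
  by move=> Gg w p /UW; exact: (smooth_on_regular_domain _ _ _ _ _ _ Gg).
split=> //.
have DB (z : R) : is_derive z (1 : R) B (2 * sin z * cos z).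
  by apply: eq_is_derive (is_deriveX 2 (is_derive_sin z)) _ _.
have DA (z : R) : is_derive z (1 : R) A (2 * (c ^+ 2 - 1) * sin z * cos z).
  apply: eq_is_derive (is_deriveD
    (is_deriveM (is_derive_cst (c ^+ 2) z 1) (DB z))
    (is_deriveX 2 (is_derive_cos z))) _ _ => //.
  by rewrite /GRing.scale/=; ring.
apply: (euler_lagrange_wave_map DA DB) => //.
- move=> z; apply: cvgM; last exact: continuous_cos.
  by apply: cvgM; [exact: cvg_cst|exact: continuous_sin].
- move=> z; apply: cvgM; last exact: continuous_cos.
  by apply: cvgM; [exact: cvg_cst|exact: continuous_sin].
- exact: smoothU (generator_colatitude theta omega a b k).
- exact: smoothU (generator_longitude theta omega a b k).
- move=> p /UW Wp; have [s0 _ _] := sin_colatitude Wp.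
  have s2 : 0 < sin (Rf p) ^+ 2 by rewrite exprn_gt0.
  split=> //; rewrite /A ltr_pwDl ?sqr_ge0// mulr_gt0//.
  by rewrite exprn_gt0// (lt_trans ltr01).
- by move=> p /UW Wp; exact: (solution_euler_lagrange_colatitude dk wk Wp).
- by move=> p /UW Wp; exact: (solution_euler_lagrange_longitude dk Wp).
Qed.
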